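(* Let $G(\mathcal V,\mathcal E)$ be a directed graph on $n$ agents, $d_{\max}=\max_{j\in\mathcal V}d_j^-$, and let $\mathcal F\subseteq\mathcal V$, $|\mathcal F|\le f<n$, be the set of agents that crash in an execution of Algorithm 5, $\mathcal N=\mathcal V-\mathcal F$. Let $\gamma\ge1$ and $$\beta\le\frac1{(d_{\max}+1)^n}.$$ If each reduced graph under crash faults contains a source component of size at least $\gamma$, then Algorithm 5 optimizes a function in $\widetilde{\mathcal A}(\beta,\gamma)$; that is, $$\lim_{t\to\infty}|x_i[t]-x_j[t]|=0\ \text{ for all } i,j\in\mathcal N,\qquad \lim_{t\to\infty}\mathrm{Dist}\big(x_i[t],\widetilde Y(\beta,\gamma)\big)=0\ \text{ for all } i\in\mathcal N.$$
   Context: **System.** A synchronous system of $n$ agents $\mathcal V=\{1,\dots,n\}$ communicates over a directed graph $G(\mathcal V,\mathcal E)$ without self-loops; $N_i^-=\{j:(j,i)\in\mathcal E\}$, $d_i^-=|N_i^-|$. The agents of $\mathcal F$ crash at some point of the execution. $\mathcal N[t]$ is the set of agents that have not crashed by the beginning of iteration $t\ge1$, $\bar{\mathcal N}[t]=\mathcal N[t+1]$ the set of those that have not crashed by the end of iteration $t$. **Local functions.** $\mathcal X\subseteq\mathbb R$ is a nonempty closed convex set and $L$ is a fixed constant. Each agent $i$ has an admissible function $h_i:\mathcal X\to\mathbb R$: convex, continuously differentiable, $h_i'$ is $L$-Lipschitz, $|h_i'(x)|\le L$ on $\mathcal X$, and $\arg\min_{x\in\mathcal X}h_i(x)$ is nonempty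 and compact. $P_{\mathcal X}$ is the projection onto $\mathcal X$; $\mathrm{Dist}(x,S)=\inf_{y\in S}|x-y|$. **Reduced graphs.** A reduced graph under crash faults is obtained from $G$ by removing all edges incident to the nodes of some $F\subseteq\mathcal F$. Its source component is the collection of nodes of $\mathcal V-F$ each of which has a directed path, in the subgraph induced by $\mathcal V-F$, to every other node of $\mathcal V-F$ (it exists if this collection is nonempty). **Valid functions.** $\widetilde{\mathcal A}(\beta,\gamma)$ is the set of functions $p=\sum_{i\in\mathcal V}\alpha_ih_i$ with $\alpha_i\ge0$, $\sum_{i\in\mathcal V}\alpha_i=1$ and $|\{i\in\mathcal N:\alpha_i\ge\beta\}|\ge\gamma$; $\widetilde Y(\beta,\gamma)=\bigcup_{p\in\widetilde{\mathcal A}(\beta,\gamma)}\arg\min_{x\in\mathcal X}p(x)$. **Stepsizes.** $\lambda[t]>0$, $\lambda[t+1]\le\lambda[t]$ for $t\ge 0$, $\sum_t\lambda[t]=\infty$, $\sum_t\lambda^2[t]<\infty$. **Algorithm 5.** Each agent $i$ has an initial state $x_i[0]\in\mathcal X$. In iteration $t\ge1$ each agent $i\in\mathcal N[t]$ sends $x_i[t-1]$ on all outgoing edges, receives values from a set $\mathcal R_i(t)$ of agents with $N_i^-\cap\bar{\mathcal N}[t]\subseteq\mathcal R_i(t)\subseteq N_i^-\cap\mathcal N[t]$ (an agent crashing during iteration $t$ may reach only some of its out-neighbours), lets $\ell_i(t)=|\mathcal R_i(t)|$, and (if it does not crash) updates $$x_i[t]=P_{\mathcal X}\Big[\tfrac1{\ell_i(t)+1}\sum_{j\in\mathcal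 R_i(t)\cup\{i\}}x_j[t-1]-\lambda[t-1]\,h_i'(x_i[t-1])\Big].$$ *)

(* Defs.v *)
From mathcomp Require Import all_boot all_order all_algebra.
From mathcomp Require Import all_classical all_reals all_analysis.

Set Implicit Arguments.
Unset Strict Implicit.
Unset Printing Implicit Defensive.

Import Order.TTheory GRing.Theory Num.Theory.
Import numFieldNormedType.Exports.

Local Open Scope classical_set_scope.
Local Open Scope ring_scope.

Definition argmin (R : realType) (X : set R) (p : R -> R) : set R :=
  [set x | X x /\ forall y, X y -> p x <= p y].

(* The nearest point exists and is unique when X is nonempty, closed and
   convex, which is the only case in which the default value of [get] does not
   matter. *)
Definition proj_onto (R : realType) (X : set R) (y : R) : R :=
  get (argmin X (fun z => `|y - z|)).

(* The infimum is taken in the extended reals so that the distance to the empty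
   set is +oo: the real-valued [inf] would give 0. *)
Definition dist (R : realType) (x : R) (S : set R) : \bar R :=
  ereal_inf [set (`|x - y|)%:E | y in S].

(* g' is the derivative of g on X, the increments being restricted to X; at an
   endpoint of X it is thus the one-sided derivative.  If X is a single point
   there is no increment and g' is unconstrained. *)
Definition derivative_on (R : realType) (X : set R) (g g' : R -> R) : Prop :=
  forall x, X x -> (g y - g x) / (y - x) @[y --> within X x^'] --> g' x.

(* A function X -> R is represented by a total function R -> R of which only
   the values on X are used. *)
Record admissible (R : realType) (X : set R) (L : R) (g g' : R -> R) : Prop :=
  Admissible {
    adm_convex : @convex_function R R^o X g ;
    adm_derivative : derivative_on X g g' ;
    adm_continuous : {within X, continuous g'} ;
    adm_lipschitz : L.-lipschitz_X g' ;
    adm_bounded : forall x, X x -> `|g' x| <= L ;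
    adm_argmin_neq0 : argmin X g !=set0 ;
    adm_argmin_compact : compact (argmin X g)
  }.

Record stepsizes (R : realType) (lambda : nat -> R) : Prop := Stepsizes {
  step_gt0 : forall t, 0 < lambda t ;
  step_nonincreasing : forall t, lambda t.+1 <= lambda t ;
  step_series : series lambda @ \oo --> +oo ;
  step_series2 : cvgn (series (fun t => lambda t ^+ 2))
}.

(* A directed graph on n nodes is given by [e : rel 'I_n], with [e j i] meaning
   that (j, i) is an edge. *)
Definition in_neighbours (n : nat) (e : rel 'I_n) (i : 'I_n) : {set 'I_n} :=
  [set j | e j i]%SET.

Definition max_in_degree (n : nat) (e : rel 'I_n) : nat :=
  (\max_(j < n) #|in_neighbours e j|)%N.

Definition reduced_graph (n : nat) (e : rel 'I_n) (F : {set 'I_n}) : rel 'I_n :=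
  [rel i j | [&& i \notin F, j \notin F & e i j]].

(* Empty when the reduced graph has no source component. *)
Definition source_component (n : nat) (e : rel 'I_n) (F : {set 'I_n}) :
    {set 'I_n} :=
  [set i in ~: F | [forall j in ~: F, connect (reduced_graph e F) i j]]%SET.

Definition valid_functions (R : realType) (n : nat) (h : 'I_n -> R -> R)
    (N : {set 'I_n}) (beta : R) (gamma : nat) : set (R -> R) :=
  [set p | exists alpha : 'I_n -> R,
     [/\ forall i, 0 <= alpha i,
         \sum_(i < n) alpha i = 1,
         (gamma <= #|[set i in N | (beta <= alpha i)%R]%SET|)%N &
         p = (fun x => \sum_(i < n) alpha i * h i x)]].

Definition valid_optima (R : realType) (X : set R) (n : nat)
    (h : 'I_n -> R -> R) (N : {set 'I_n}) (beta : R) (gamma : nat) : set R :=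
  \bigcup_(p in valid_functions h N beta gamma) argmin X p.

(* [alive t] is, for t >= 1, the set of agents that have not crashed by the
   beginning of iteration t, hence [alive t.+1] is the set of those that have
   not crashed by the end of it; [alive 0] is not used.  F is exactly the set of
   the agents that crash. *)
Record crash_pattern (n : nat) (F : {set 'I_n}) (alive : nat -> {set 'I_n}) :
    Prop := CrashPattern {
  crash_permanent : forall t, alive t.+2 \subset alive t.+1 ;
  crash_set : forall i, i \in F <-> exists t, i \notin alive t.+1
}.

(* [x t i] is the state of agent i at the end of iteration t ([x 0 i] is the
   initial state) and [rcv t i] the set of agents from which i receives a value
   in iteration t >= 1.  All clauses below but the first are about iteration
   t + 1.  The state of an agent that has crashed is left unconstrained. *)
Record execution (R : realType) (X : set R) (n : nat) (e : rel 'I_n)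
    (dh : 'I_n -> R -> R) (lambda : nat -> R) (alive : nat -> {set 'I_n})
    (rcv : nat -> 'I_n -> {set 'I_n}) (x : nat -> 'I_n -> R) : Prop :=
  Execution {
    exec_init : forall i, X (x 0 i) ;
    exec_rcv_lb : forall t i, i \in alive t.+1 ->
      in_neighbours e i :&: alive t.+2 \subset rcv t.+1 i ;
    exec_rcv_ub : forall t i, i \in alive t.+1 ->
      rcv t.+1 i \subset in_neighbours e i :&: alive t.+1 ;
    exec_update : forall t i, i \in alive t.+2 ->
      x t.+1 i =
        proj_onto X ((#|rcv t.+1 i|.+1%:R)^-1
                  * (\sum_(j in i |: rcv t.+1 i) x t j)
                - lambda t * dh i (x t i))
  }.

(* Main.v *)
(* Once every agent of F has crashed, the agents of N average with a fixed
   row-stochastic matrix A.  A stationary distribution pi of A vanishes on F,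
   and since a node of the source component of the reduced graph reaches every
   node of N in fewer than n steps, its column in A^n, hence its weight in pi, is
   at least (d_max + 1)^-n.  So p = sum_i pi_i h_i is a valid function, and the
   same column makes A^n contract the diameter of the states; the gradient steps
   being vanishing perturbations, consensus follows.

   Let [a, b] be the set of minimizers of p.  Since b is in X, projecting onto X
   cannot push a point above b, so x_i[t+1] <= max(v_i - lambda h_i'(x_i), b)
   with v = A x.  If the pi-average y of the states exceeds b + eps, then near
   consensus y decreases by at least lambda delta, where delta depends on
   p'(b + eps) > 0; as sum lambda diverges, y eventually stays below b + O(eps).
   The bound from below by a is symmetric. *)
Require Import Defs.
From mathcomp Require Import all_boot all_order all_algebra.
From mathcomp Require Import all_classical all_reals all_analysis.
From mathcomp Require Import lra ring.

Set Implicit Arguments.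
Unset Strict Implicit.
Unset Printing Implicit Defensive.

Import Order.TTheory GRing.Theory Num.Theory.
Import numFieldNormedType.Exports.

Local Open Scope classical_set_scope.
Local Open Scope ring_scope.

(** * Stochastic matrices *)

Definition stochastic (R : realType) (n : nat) (A : 'M[R]_n) : Prop :=
  (forall i j, 0 <= A i j) /\ (forall i, \sum_j A i j = 1).

Definition stationary (R : realType) (n : nat) (A : 'M[R]_n) (pi : 'I_n -> R) :
    Prop :=
  [/\ forall i, 0 <= pi i, \sum_i pi i = 1
    & forall j, \sum_i pi i * A i j = pi j].

(** The matrix [A - 1%:M] kills the all-ones column, so it is singular and some nonzero row [u]
    satisfies [u = u A]. The absolute values of its entries, divided by their sum, form [pi]. *)
Lemma stationary_exists (R : realType) (n : nat) (A : 'M[R]_n) :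
  (0 < n)%N -> stochastic A -> exists pi, stationary A pi.
Proof.
move=> n_gt0 [A_ge0 A_sum1].
have A1 : (A - 1%:M) *m const_mx 1 = 0 :> 'cV[R]_n.
  apply/matrixP => i k; rewrite mulmxBl mul1mx !mxE.
  under eq_bigr do rewrite mxE mulr1.
  by rewrite A_sum1 subrr.
have : kermx (A - 1%:M) != 0.
  rewrite kermx_eq0 row_free_unit; apply/negP => unitB.
  have := congr1 (mulmx (invmx (A - 1%:M))) A1.
  rewrite mulKmx // mulmx0 => /matrixP /(_ (Ordinal n_gt0) 0) /eqP.
  by rewrite !mxE oner_eq0.
case/rowV0Pn => u /sub_kermxP; rewrite mulmxBr mulmx1 => /subr0_eq uA u_neq0.
have uE j : u 0 j = \sum_i u 0 i * A i j by rewrite -{1}uA mxE.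
pose s := \sum_i `|u 0 i|.
have le_uA j : `|u 0 j| <= \sum_i `|u 0 i| * A i j.
  rewrite uE (le_trans (ler_norm_sum _ _ _)) //; apply: ler_sum => i _.
  by rewrite normrM (ger0_norm (A_ge0 _ _)).
have s_gt0 : 0 < s.
  rewrite lt_def sumr_ge0 // andbT; apply: contraNneq u_neq0 => s0.
  apply/eqP/matrixP => k j; rewrite mxE (ord1 k); apply/eqP.
  by rewrite -normr_eq0 (psumr_eq0P _ s0).
(* Both sides of the entrywise inequality [|u| <= |u| A] have the same sum. *)
have abs_uA j : \sum_i `|u 0 i| * A i j = `|u 0 j|.
  apply/eqP; rewrite eq_sym -subr_eq0 -oppr_eq0 opprB.
  have sum0 : \sum_j (\sum_i `|u 0 i| * A i j - `|u 0 j|) = 0.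
    rewrite sumrB exchange_big /=.
    under eq_bigr do rewrite -mulr_sumr A_sum1 mulr1.
    by rewrite subrr.
  by rewrite (psumr_eq0P _ sum0) // => k _; rewrite subr_ge0.
exists (fun i => `|u 0 i| / s); split=> [i||j].
- by rewrite divr_ge0 // ltW.
- by rewrite -mulr_suml divff // gt_eqF.
- by rewrite -abs_uA mulr_suml; apply: eq_bigr => i _; rewrite mulrAC.
Qed.

Lemma stochasticX (R : realType) (n : nat) (A : 'M[R]_n) (k : nat) :
  stochastic A -> stochastic (A ^+ k).
Proof.
move=> [A_ge0 A_sum1]; elim: k => [|k [IH_ge0 IH_sum1]].
  rewrite expr0; split=> [i j|i]; first by rewrite mxE ler0n.
  rewrite (bigD1 i) //= big1 ?mxE ?eqxx ?addr0 // => j ji.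
  by rewrite mxE eq_sym (negbTE ji).
rewrite exprS; split=> [i j|i].
  by rewrite mxE sumr_ge0 // => l _; rewrite mulr_ge0.
under eq_bigr do rewrite mxE.
rewrite exchange_big /=.
by under eq_bigr do rewrite -mulr_sumr IH_sum1 mulr1.
Qed.

Lemma stationaryX (R : realType) (n : nat) (A : 'M[R]_n) (pi : 'I_n -> R) (k : nat) :
  stationary A pi -> stationary (A ^+ k) pi.
Proof.
move=> [pi_ge0 pi_sum1 piA]; split=> //; elim: k => [|k IH] j.
  rewrite expr0 (bigD1 j) //= big1 ?mxE ?eqxx ?mulr1 ?addr0 // => i ij.
  by rewrite mxE (negbTE ij) mulr0.
rewrite exprS.
under eq_bigr do rewrite mxE mulr_sumr.
rewrite exchange_big /= -[RHS]IH; apply: eq_bigr => l _.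
by under eq_bigr do rewrite mulrA; rewrite -mulr_suml piA.
Qed.

Lemma average_expr (R : realType) (n : nat) (A : 'M[R]_n) (x : 'I_n -> R) k i :
  \sum_j (A ^+ k.+1) i j * x j
  = \sum_j (A ^+ k) i j * (\sum_l A j l * x l).
Proof.
rewrite exprSr.
under eq_bigr do rewrite mxE mulr_suml.
rewrite exchange_big /=; apply: eq_bigr => j _; rewrite mulr_sumr.
by apply: eq_bigr => l _; rewrite mulrA.
Qed.

Lemma stationary_average (R : realType) (n : nat) (A : 'M[R]_n) pi (x : 'I_n -> R) :
  stationary A pi -> \sum_i pi i * (\sum_j A i j * x j) = \sum_j pi j * x j.
Proof.
move=> [_ _ piA]; under eq_bigr do rewrite mulr_sumr.
rewrite exchange_big /=; apply: eq_bigr => j _.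
by under eq_bigr do rewrite mulrA; rewrite -mulr_suml piA.
Qed.

(** * Weighted averages and the spread of the states *)

Lemma ler_average (R : realType) (n : nat) (w x y : 'I_n -> R) :
  (forall j, 0 <= w j) -> (forall j, x j <= y j) ->
  \sum_j w j * x j <= \sum_j w j * y j.
Proof. by move=> w_ge0 xy; apply: ler_sum => j _; rewrite ler_wpM2l. Qed.

Lemma average_le (R : realType) (n : nat) (w x : 'I_n -> R) (c : R) :
  (forall j, 0 <= w j) -> \sum_j w j = 1 ->
  (forall j, x j <= c) -> \sum_j w j * x j <= c.
Proof.
move=> w_ge0 w1 xc; apply: le_trans (ler_average w_ge0 xc) _.
by rewrite -mulr_suml w1 mul1r.
Qed.

Lemma average_ge (R : realType) (n : nat) (w x : 'I_n -> R) (c : R) :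
  (forall j, 0 <= w j) -> \sum_j w j = 1 ->
  (forall j, c <= x j) -> c <= \sum_j w j * x j.
Proof.
move=> w_ge0 w1 xc; apply: le_trans (ler_average w_ge0 xc).
by rewrite -mulr_suml w1 mul1r.
Qed.

Lemma average_interval (R : realType) (X : set R) (n : nat) (w x : 'I_n -> R) :
  is_interval X -> (forall j, 0 <= w j) -> \sum_j w j = 1 ->
  (forall j, X (x j)) -> X (\sum_j w j * x j).
Proof.
move=> itvX w_ge0 w1 Xx; case: n => [|n] in w x w_ge0 w1 Xx *.
  by move/eqP: w1; rewrite big_ord0 eq_sym oner_eq0.
case: (@arg_minP _ _ _ ord0 predT x isT) => i _ le_i.
case: (@arg_maxP _ _ _ ord0 predT x isT) => k _ le_k.
apply: (itvX (x i) (x k)) => //; apply/andP; split.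
  by apply: average_ge => // j; exact: le_i.
by apply: average_le => // j; exact: le_k.
Qed.

(** The diameter is bounded through an enclosing interval of length [s], because averages of values
    in an interval stay in it. *)
Definition spread_le (R : realType) (n : nat) (x : 'I_n -> R) (s : R) : Prop :=
  exists m, forall i, m <= x i <= m + s.

Lemma spread_leP (R : realType) (n : nat) (x : 'I_n -> R) (s : R) :
  spread_le x s -> forall i j, `|x i - x j| <= s.
Proof.
move=> [m xm] i j; have := xm i; have := xm j; rewrite ler_norml; lra.
Qed.

Lemma spread_le_average (R : realType) (n : nat) (x w : 'I_n -> R) (s : R) :
  (forall j, 0 <= w j) -> \sum_j w j = 1 ->
  spread_le x s -> forall i, `|x i - \sum_j w j * x j| <= s.
Proof.
move=> w_ge0 w1 [m xm] i; have := xm i.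
have : m <= \sum_j w j * x j by apply: average_ge => // j; case/andP: (xm j).
have : \sum_j w j * x j <= m + s by apply: average_le => // j; case/andP: (xm j).
rewrite ler_norml; lra.
Qed.

Lemma spread_le_exists (R : realType) (n : nat) (x : 'I_n -> R) :
  exists2 s, 0 <= s & spread_le x s.
Proof.
exists (\sum_j (`|x j| + `|x j|)); first by rewrite sumr_ge0 // => j _; rewrite addr_ge0.
exists (- \sum_j `|x j|) => i.
have : `|x i| <= \sum_j `|x j|.
  by rewrite (bigD1 i) //= lerDl sumr_ge0.
rewrite big_split /= ler_norml; lra.
Qed.

Lemma spread_le_mono (R : realType) (n : nat) (x : 'I_n -> R) (s s' : R) :
  s <= s' -> spread_le x s -> spread_le x s'.
Proof. by move=> ss' [m xm]; exists m => i; have := xm i; lra. Qed.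

Lemma spread_le_perturb (R : realType) (n : nat) (x y : 'I_n -> R) (s d : R) :
  (forall i, `|y i - x i| <= d) -> spread_le x s -> spread_le y (s + 2 * d).
Proof.
move=> yx [m xm]; exists (m - d) => i.
by have := xm i; have := yx i; rewrite ler_norml; lra.
Qed.

(** All the averages put weight at least [c] on the same value [x l], so the lower end of the
    interval moves up by [c * (x l - m)] and the upper end down by [c * (m + s - x l)]; together
    these remove [c * s]. *)
Lemma spread_le_contract (R : realType) (n : nat) (P : 'M[R]_n) (c : R) (l : 'I_n)
    (x : 'I_n -> R) (s : R) :
  stochastic P -> (forall i, c <= P i l) -> spread_le x s ->
  spread_le (fun i => \sum_j P i j * x j) ((1 - c) * s).
Proof.
move=> [P_ge0 P1] cP [m xm]; exists (m + c * (x l - m)) => i.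
have split_l (z : R) :
    \sum_j P i j * x j = z + \sum_j P i j * (x j - z).
  under [in RHS]eq_bigr do rewrite mulrBr.
  by rewrite sumrB -mulr_suml P1 mul1r addrC subrK.
have /andP[xl1 xl2] := xm l.
apply/andP; split.
  rewrite (split_l m) lerD2l (bigD1 l) //= -[leLHS]addr0 lerD //.
    by rewrite ler_wpM2r ?subr_ge0.
  by apply: sumr_ge0 => j _; rewrite mulr_ge0 ?subr_ge0 //; case/andP: (xm j).
rewrite (split_l (m + s)) (bigD1 l) //=.
have : P i l * (x l - (m + s)) <= c * (x l - (m + s)).
  by rewrite ler_wnM2r ?subr_le0.
have : \sum_(j | j != l) P i j * (x j - (m + s)) <= 0.
  by apply: sumr_le0 => j _; rewrite mulr_ge0_le0 ?subr_le0 //; case/andP: (xm j).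
lra.
Qed.

(** * Consensus and one-sided descent *)

(** An error made in one step is merely averaged by the later stochastic steps, so it never grows,
    and [k] of them add up to at most [k%:R * d]. *)
Lemma average_steps (R : realType) (n : nat) (A : 'M[R]_n) (x : nat -> 'I_n -> R)
    (d : R) (t0 : nat) :
  stochastic A ->
  (forall t i, (t0 <= t)%N -> `|x t.+1 i - \sum_j A i j * x t j| <= d) ->
  forall k t i, (t0 <= t)%N ->
  `|x (t + k)%N i - \sum_j (A ^+ k) i j * x t j| <= k%:R * d.
Proof.
move=> stA xA; elim=> [|k IH] t i t0t.
  rewrite addn0 expr0 mul0r (bigD1 i) //= big1 => [|j ji].
    by rewrite mxE eqxx mul1r addr0 subrr normr0.
  by rewrite mxE eq_sym (negbTE ji) mul0r.
rewrite average_expr -addSnnS -natr1 mulrDl mul1r.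
have := IH t.+1 i (leqW t0t).
have : `|\sum_j (A ^+ k) i j * x t.+1 j
         - \sum_j (A ^+ k) i j * (\sum_l A j l * x t l)| <= d.
  rewrite -sumrB; under eq_bigr do rewrite -mulrBr.
  have [Ak_ge0 Ak1] := stochasticX k stA.
  rewrite ler_norml average_ge ?average_le // => j;
    by have := xA t j t0t; rewrite ler_norml => /andP[].
rewrite !ler_norml; lra.
Qed.

(** Over [k] steps a spread [s] becomes at most [(1 - c) * s] plus twice the accumulated error. The
    times past [t0] are split into classes modulo [k], and the bound is iterated in each class. *)
Lemma consensus (R : realType) (n : nat) (A : 'M[R]_n) (x : nat -> 'I_n -> R)
    (c : R) (k : nat) (l : 'I_n) :
  stochastic A -> 0 < c -> (0 < k)%N -> (forall i, c <= (A ^+ k) i l) ->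
  (forall d, 0 < d ->
     \forall t \near \oo, forall i, `|x t.+1 i - \sum_j A i j * x t j| <= d) ->
  forall eps, 0 < eps -> \forall t \near \oo, spread_le (x t) eps.
Proof.
move=> stA c_gt0 k_gt0 cA x_step eps eps_gt0.
have k_gt0R : 0 < k%:R :> R by rewrite ltr0n.
(* This makes [eps / 2] the fixed point of [s |-> (1 - c) * s + 2 * (k%:R * d)]. *)
pose d := c * eps / (4 * k%:R).
have d_gt0 : 0 < d by rewrite divr_gt0 ?mulr_gt0.
have kd : 2 * (k%:R * d) = c * (eps / 2).
  by rewrite /d; field; rewrite gt_eqF.
have [t0 _ x_t0] := x_step d d_gt0.
have ksteps := average_steps stA (fun t i t0t => x_t0 t t0t i).
have [Ak_ge0 Ak1] := stochasticX k stA.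
have c_le1 : c <= 1.
  by rewrite (le_trans (cA l)) // -(Ak1 l) (bigD1 l) //= lerDl sumr_ge0.
have [K K_ge0 xK] : exists2 K, 0 <= K &
    forall r, (r < k)%N -> spread_le (x (t0 + r)%N) K.
  elim: (k) => [|m [K K_ge0 xK]]; first by exists 0.
  have [s s_ge0 xs] := spread_le_exists (x (t0 + m)%N).
  exists (K + s) => [|r]; first exact: addr_ge0.
  rewrite ltnS leq_eqVlt => /predU1P[->|rm].
    by apply: spread_le_mono xs; rewrite lerDr.
  by apply: spread_le_mono (xK r rm); rewrite lerDl.
have contract r m : (r < k)%N ->
    spread_le (x (t0 + r + m * k)%N) ((1 - c) ^+ m * K + eps / 2).
  move=> rk; elim: m => [|m IH].
    rewrite mul0n addn0 expr0 mul1r; apply: spread_le_mono (xK r rk).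
    by rewrite lerDl divr_ge0 // ltW.
  rewrite mulSn [(k + _)%N]addnC addnA.
  apply: spread_le_mono
    (spread_le_perturb (ksteps k _ ^~ _) (spread_le_contract _ cA IH)).
  - by rewrite kd exprS; lra.
  - by rewrite -addnA leq_addr.
  - exact: stochasticX.
have [m0 _ small] : \forall m \near \oo, (1 - c) ^+ m * K <= eps / 2.
  have q_cvg : ((1 - c) ^+ m * K) @[m --> \oo] --> 0 * K.
    by apply: cvgMl; apply: cvg_expr; rewrite ger0_norm; lra.
  move: q_cvg; rewrite mul0r => /cvgrPdist_le /(_ (eps / 2)).
  rewrite divr_gt0 // => /(_ isT); apply: filterS => m.
  rewrite sub0r normrN; exact: le_trans (ler_norm _).
exists (t0 + m0 * k)%N => // t /= t_ge.
have t0t : (t0 <= t)%N by apply: leq_trans t_ge; rewrite leq_addr.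
have -> : t = (t0 + (t - t0) %% k + (t - t0) %/ k * k)%N.
  by rewrite -addnA [(_ %% _ + _)%N]addnC -divn_eq subnKC.
apply: spread_le_mono (contract _ _ _); last by rewrite ltn_mod.
rewrite [leRHS](splitr eps) lerD2r small //=.
by rewrite leq_divRL // -(leq_add2l t0) subnKC.
Qed.

(** Once [y] is below [B], the maximum keeps it there. Were [y] to stay above [B], each step would
    lower it by at least [lambda t * c], and these decrements have infinite sum. *)
Lemma descent_below (R : realType) (lambda y : nat -> R) (c B : R) :
  (forall t, 0 < lambda t) -> series lambda @ \oo --> +oo -> 0 < c ->
  (\forall t \near \oo, y t.+1 <= Num.max (y t - lambda t * c) B) ->
  \forall t \near \oo, y t <= B.
Proof.
move=> lambda_gt0 lambda_series c_gt0 [t0 _ y_step].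
have [[t1 t01 yt1]|above] := pselect (exists2 t, (t0 <= t)%N & y t <= B).
  exists t1 => // t /=; elim: t => [|t IH] t1t.
    by move: t1t yt1; rewrite leqn0 => /eqP ->.
  move: t1t; rewrite leq_eqVlt => /predU1P[<- //|]; rewrite ltnS => t1t.
  have := y_step t (leq_trans t01 t1t).
  have := IH t1t; have := mulr_gt0 (lambda_gt0 t) c_gt0.
  by rewrite le_max; case: (lerP (y t.+1) B) => //; rewrite orbF; lra.
have y_gt t : (t0 <= t)%N -> B < y t.
  by move=> t0t; rewrite ltNge; apply/negP => yt; apply: above; exists t.
have y_sum m : y (t0 + m)%N <= y t0 - (series lambda (t0 + m)%N - series lambda t0) * c.
  elim: m => [|m IH]; first by rewrite addn0 subrr mul0r subr0.
  have := y_step (t0 + m)%N (leq_addr _ _).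
  rewrite le_max [_ <= B]leNgt y_gt ?(leqW (leq_addr _ _)) // orbF => y_dec.
  move: IH; rewrite addnS !seriesEnat /= (big_nat_recr (t0 + m)) //= => IH; lra.
have /cvgryPge /(_ (series lambda t0 + (y t0 - B) / c)) [t1 _ big_series] :=
  lambda_series.
have := big_series (t0 + t1)%N (leq_addl _ _).
have := y_sum t1; have := y_gt (t0 + t1)%N (leq_addr _ _).
rewrite /= -lerBrDl ler_pdivrMr //; lra.
Qed.

(** Here [g] stands for the gradients and the maximum with [b] for the effect of projecting. The
    statement is one-sided so that it can be applied again to negated states and gradients. *)
Lemma eventually_below (R : realType) (n : nat) (A : 'M[R]_n) (pi : 'I_n -> R)
    (x g : nat -> 'I_n -> R) (lambda : nat -> R) (b : R) :
  stochastic A -> stationary A pi ->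
  (forall t, 0 < lambda t) -> series lambda @ \oo --> +oo ->
  (\forall t \near \oo, forall i,
     x t.+1 i <= Num.max (\sum_j A i j * x t j - lambda t * g t i) b) ->
  (forall d, 0 < d ->
     \forall t \near \oo, forall i, `|lambda t * g t i| <= d) ->
  (forall d, 0 < d -> \forall t \near \oo, spread_le (x t) d) ->
  (forall eps, 0 < eps -> exists2 d, 0 < d &
     \forall t \near \oo, b + eps <= \sum_i pi i * x t i ->
       d <= \sum_i pi i * g t i) ->
  forall eps, 0 < eps -> \forall t \near \oo, forall i, x t i <= b + eps.
Proof.
move=> stA stpi lambda_gt0 lambda_series x_step small_step agree ascent eps eps_gt0.
have [A_ge0 A1] := stA; have [pi_ge0 pi1 _] := stpi.
pose y t := \sum_i pi i * x t i.
(* The budget of [5 * u]: two for the threshold on [y], two for a step taken from below it, one for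
   the distance between a state and [y]. *)
pose u := eps / 5.
have u_gt0 : 0 < u by rewrite divr_gt0.
have u5 : eps = 5 * u by rewrite /u; field.
have [d d_gt0 ascent_d] := ascent (2 * u) (mulr_gt0 (ltr0n _ 2) u_gt0).
have agree_u := agree _ u_gt0; have small_u := small_step _ u_gt0.
have y_below : \forall t \near \oo, y t <= b + 4 * u.
  apply: (@descent_below _ lambda _ d) => //.
  near=> t.
  have up : forall i, x t.+1 i
      <= Num.max (\sum_j A i j * x t j - lambda t * g t i) b by near: t.
  have ag : spread_le (x t) u by near: t.
  have sm : forall i, `|lambda t * g t i| <= u by near: t.
  have asc : b + 2 * u <= y t -> d <= \sum_i pi i * g t i by near: t.
  have v_near i : `|y t - \sum_j A i j * x t j| <= u.
    rewrite /y -(stationary_average _ stpi) distrC.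
    apply: (spread_le_average (x := fun i => \sum_j A i j * x t j)) => //.
    have [m xm] := ag; exists m => l.
    by apply/andP; split; [apply: average_ge | apply: average_le] => // j;
      case/andP: (xm j).
  rewrite le_max; have [y_ge|y_lt] := leP (b + 2 * u) (y t).
    apply/orP; left.
    have up' i : x t.+1 i <= \sum_j A i j * x t j - lambda t * g t i.
      have := up i; rewrite le_max => /orP[//|]; have := v_near i; have := sm i.
      by rewrite !ler_norml; lra.
    apply: (le_trans (ler_average pi_ge0 up')).
    under eq_bigr do rewrite mulrBr mulrCA.
    rewrite sumrB stationary_average // -mulr_sumr lerD2l lerN2 ler_pM2l //.
    exact: asc.
  apply/orP; right; apply: average_le => // i.
  apply: (le_trans (up i)); rewrite ge_max; have := v_near i; have := sm i.
  by rewrite !ler_norml; lra.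
near=> t => i.
have yt : y t <= b + 4 * u by near: t.
have ag : spread_le (x t) u by near: t.
by have := spread_le_average pi_ge0 pi1 ag i; rewrite ler_norml -/(y t); lra.
Unshelve. all: by end_near.
Qed.

(** * Convex functions on an interval *)

Lemma convex_set_interval (R : realType) (X : set R) :
  @convex_set R R^o X -> is_interval X.
Proof.
move=> cX a b Xa Xb z /andP[az zb].
have [ab|ab] := eqVneq a b.
  by have -> : z = a by apply/eqP; rewrite eq_le az ab zb.
have lt_ab : a < b by rewrite lt_neqAle ab (le_trans az zb).
pose t := (b - z) / (b - a).
have t_ge0 : 0 <= t by rewrite divr_ge0 ?subr_ge0 // ltW.
have t_le1 : t <= 1.
  by rewrite ler_pdivrMr ?subr_gt0 // mul1r lerD2l lerN2.
have := cX a b (Itv01 t_ge0 t_le1) (mem_set Xa) (mem_set Xb).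
rewrite inE => Xc; move: (Xc : X (t * a + (1 - t) * b)).
by congr (X _); rewrite /t; field; rewrite subr_eq0 eq_sym.
Qed.

Lemma lipschitz_within (R : realType) (A : set R) (f : R -> R) (k : R) :
  (forall x y, A x -> A y -> `|f x - f y| <= k * `|x - y|) ->
  {within A, continuous f}.
Proof.
move=> f_lip; apply/subspace_continuousP => x Ax.
apply/cvgrPdist_le => eps eps_gt0.
have k_gt0 : 0 < `|k| + 1 by rewrite ltr_pwDr.
exists (eps / (`|k| + 1)) => /=; first exact: divr_gt0.
move=> y; rewrite /ball_ /= ltr_pdivlMr // => xy Ay.
have := f_lip _ _ Ax Ay; have := ler_norm k; have := normr_ge0 (x - y); nra.
Qed.

(** Points of [X] farther from [w] than [x0] cannot be nearest, so the minimum is attained on a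
    compact piece of [X]; hence [get] does not return its default value. *)
Lemma proj_ontoP (R : realType) (X : set R) (w : R) :
  X !=set0 -> closed X -> argmin X (fun z => `|w - z|) (proj_onto X w).
Proof.
move=> [x0 Xx0] clX.
have C_neq0 : (`[w - `|w - x0|, w + `|w - x0|]%classic `&` X) !=set0.
  exists x0; split => //=; rewrite in_itv /=.
  by have := lexx `|w - x0|; rewrite ler_norml; lra.
have [|z zC z_min] :=
  compact_EVT_min (f := fun z => `|w - z|) C_neq0
    (compact_closedI (@segment_compact _ _ _) clX).
  apply: (@lipschitz_within _ _ _ 1) => u v _ _; rewrite mul1r.
  rewrite (le_trans (ler_dist_dist _ _)) // [leRHS]distrC.
  by have -> : w - u - (w - v) = v - u by ring.
move: zC; rewrite inE => -[_ Xz].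
apply: xgetPex; exists z; split=> // y Xy.
have [near_y|far_y] := leP `|w - y| `|w - x0|.
  apply: z_min; rewrite inE; split => //=; rewrite in_itv /=.
  by move: near_y; rewrite ler_norml; lra.
apply: le_trans (ltW far_y); apply: z_min; rewrite inE; split => //=.
by rewrite in_itv /=; have := lexx `|w - x0|; rewrite ler_norml; lra.
Qed.

(** If the projection fell beyond [w], then [w] would lie between it and [v], hence in [X], and be
    its own projection. It cannot fall beyond [v], which would be nearer to [w]. *)
Lemma proj_onto_between (R : realType) (X : set R) (w v : R) :
  is_interval X -> closed X -> X v ->
  Num.min w v <= proj_onto X w <= Num.max w v.
Proof.
move=> itvX clX Xv.
have [XP P_min] := proj_ontoP w (ex_intro _ v Xv) clX.
have Pv := P_min v Xv.
have fixed : X w -> proj_onto X w = w.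
  move=> /P_min; rewrite subrr normr0 normr_le0 subr_eq0 => /eqP <- //.
set P := proj_onto X w in XP Pv fixed *.
rewrite ge_min le_max; case: (lerP w v) => [wv|vw].
  have wP : w <= P.
    rewrite leNgt; apply/negP => Pw; move: (Pw); rewrite fixed ?ltxx //.
    by apply: (itvX P v) => //; rewrite wv ltW.
  have Pv' : P <= v by move: Pv; rewrite !ler0_norm ?subr_le0 //; lra.
  by rewrite wP Pv' orbT.
have Pw : P <= w.
  rewrite leNgt; apply/negP => wP; move: (wP); rewrite fixed ?ltxx //.
  by apply: (itvX v P) => //; rewrite !ltW.
have vP : v <= P.
  by move: Pv; rewrite !ger0_norm ?subr_ge0 ?(ltW vw) //; lra.
by rewrite Pw vP orbT.
Qed.

(** Once established for each local function, this tangent inequality carries the convexity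
    arguments, and it passes to weighted sums term by term. *)
Definition subgradient (R : realType) (X : set R) (p q : R -> R) : Prop :=
  forall x y, X x -> X y -> p x + q x * (y - x) <= p y.

(** On the segment from [x] to [y], convexity bounds the increment of [g] by a proportional share of
    [g y - g x]. Dividing by that share and approaching [x] gives the tangent inequality. *)
Lemma admissible_subgradient (R : realType) (X : set R) (L : R) (g g' : R -> R) :
  is_interval X -> admissible X L g g' -> subgradient X g g'.
Proof.
move=> itvX adm x y Xx Xy.
have [->|xy] := eqVneq y x; first by rewrite subrr mulr0 addr0.
rewrite leNgt; apply/negP => lt_gy.
have d_gt0 : 0 < `|y - x| by rewrite normr_gt0 subr_eq0.
pose eps := (g x + g' x * (y - x) - g y) / `|y - x|.
have eps_gt0 : 0 < eps by rewrite divr_gt0 ?subr_gt0.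
have /cvgrPdist_lt /(_ eps eps_gt0) := adm_derivative adm Xx.
case=> r /= r_gt0 slope.
pose t := Num.min 1 (r / (2 * `|y - x|)).
have t_gt0 : 0 < t by rewrite lt_min ltr01 divr_gt0 ?mulr_gt0.
have t_le1 : t <= 1 by rewrite ge_min lexx.
have t_small : t * `|y - x| < r.
  apply: (@le_lt_trans _ _ (r / 2)); last by rewrite ltr_pdivrMr //; lra.
  apply: (@le_trans _ _ (r / (2 * `|y - x|) * `|y - x|)).
    by rewrite ler_pM2r // ge_min lexx orbT.
  by rewrite le_eqVlt; apply/orP; left; apply/eqP; field; rewrite gt_eqF.
pose z := x + t * (y - x).
have Xz : X z.
  have [le_xy|lt_yx] := leP x y.
    by apply: (itvX x y) => //; rewrite /z; nra.
  by apply: (itvX y x) => //; rewrite /z; nra.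
have zx : z != x.
  by rewrite -subr_eq0 /z addrC addKr mulf_neq0 ?subr_eq0 // gt_eqF.
have gz : g z <= t * g y + (1 - t) * g x.
  have := adm_convex adm (Itv01 (ltW t_gt0) t_le1) (mem_set Xy) (mem_set Xx).
  move=> g_conv; move: (g_conv : g (t * y + (1 - t) * x) <= t * g y + (1 - t) * g x).
  by congr (g _ <= _); rewrite /z; ring.
have := slope z; rewrite /ball_ /= => /(_ _ zx Xz).
have -> : z - x = t * (y - x) by rewrite /z addrC addKr.
rewrite distrC {1}/z addrC addKr normrM (gtr0_norm t_gt0) => /(_ t_small).
rewrite -(ltr_pM2r d_gt0) -normrM /eps divfK ?gt_eqF //.
have -> : (g' x - (g z - g x) / (t * (y - x))) * (y - x)
    = g' x * (y - x) - (g z - g x) / t.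
  by field; rewrite subr_eq0 xy gt_eqF.
apply/negP; rewrite -leNgt; apply: le_trans (ler_norm _).
have : (g z - g x) / t <= g y - g x by rewrite ler_pdivrMr //; lra.
lra.
Qed.

Lemma subgradient_lipschitz (R : realType) (X : set R) (L : R) (p q : R -> R) :
  subgradient X p q -> (forall x, X x -> `|q x| <= L) ->
  forall x y, X x -> X y -> `|p x - p y| <= L * `|x - y|.
Proof.
move=> sub q_le.
have half x y : X x -> X y -> p x - p y <= L * `|x - y|.
  move=> Xx Xy; have := sub x y Xx Xy.
  have : q x * (x - y) <= L * `|x - y|.
    rewrite (le_trans (ler_norm _)) // normrM ler_wpM2r //; exact: q_le.
  lra.
move=> x y Xx Xy; have := half x y Xx Xy; have := half y x Xy Xx.
by rewrite ler_norml distrC; lra.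
Qed.

Lemma subgradient_nondecreasing (R : realType) (X : set R) (p q : R -> R) :
  subgradient X p q -> forall x y, X x -> X y -> x <= y -> q x <= q y.
Proof.
move=> sub x y Xx Xy; rewrite le_eqVlt => /predU1P[-> //|xy].
have := sub x y Xx Xy; have := sub y x Xy Xx => h1 h2.
by rewrite -(@ler_pM2r _ (y - x)) ?subr_gt0 //; lra.
Qed.

Lemma subgradient_average (R : realType) (X : set R) (n : nat) (w : 'I_n -> R)
    (p q : 'I_n -> R -> R) :
  (forall i, 0 <= w i) -> (forall i, subgradient X (p i) (q i)) ->
  subgradient X (fun x => \sum_i w i * p i x) (fun x => \sum_i w i * q i x).
Proof.
move=> w_ge0 sub x y Xx Xy.
rewrite mulr_suml -big_split /=; apply: ler_sum => i _.
by rewrite -mulrA -mulrDr ler_wpM2l //; exact: sub.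
Qed.

(** The value at a point that is not minimal strictly exceeds [p z], so the tangent there must
    descend strictly towards [z]. *)
Lemma subgradient_outside_argmin (R : realType) (X : set R) (p q : R -> R)
    (z x : R) :
  subgradient X p q -> argmin X p z -> X x -> ~ argmin X p x ->
  (z < x -> 0 < q x) /\ (x < z -> q x < 0).
Proof.
move=> sub [Xz z_min] Xx x_nmin.
have pzx : p z < p x.
  rewrite ltNge; apply/negP => pxz; apply: x_nmin; split=> // y Xy.
  exact: le_trans pxz (z_min y Xy).
by have := sub x z Xx Xz; split=> ?; rewrite ltNge; apply/negP; nra.
Qed.

(** This sign condition far from the origin follows from compactness of the set of minimizers and,
    unlike it, passes to averages at once. *)
Definition coercive (R : realType) (X : set R) (q : R -> R) (K : R) : Prop :=
  forall x, X x -> (K < x -> 0 < q x) /\ (x < - K -> q x < 0).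

Lemma coercive_compact_argmin (R : realType) (X : set R) (p q : R -> R) :
  subgradient X p q -> argmin X p !=set0 -> compact (argmin X p) ->
  exists K, 0 <= K /\ coercive X q K.
Proof.
move=> sub [z z_min] /compact_bounded/pinfty_ex_gt0[K K_gt0 boundK].
exists K; split=> [|x Xx]; first exact: ltW.
have := boundK z z_min; rewrite /= ler_norml => /andP[Kz zK].
have x_nmin : K < `|x| -> ~ argmin X p x by move=> xK /boundK /=; rewrite leNgt xK.
split=> xK.
  apply: (subgradient_outside_argmin sub z_min Xx _).1; last exact: le_lt_trans xK.
  by apply: x_nmin; rewrite ltr_normr xK.
apply: (subgradient_outside_argmin sub z_min Xx _).2; last exact: lt_le_trans Kz.
by apply: x_nmin; rewrite ltr_normr ltrNr xK orbT.
Qed.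

Lemma average_gt0 (R : realType) (n : nat) (w x : 'I_n -> R) :
  (forall j, 0 <= w j) -> \sum_j w j = 1 -> (forall j, 0 < x j) ->
  0 < \sum_j w j * x j.
Proof.
move=> w_ge0 w1 x_gt0.
have wx_ge0 j : 0 <= w j * x j by rewrite mulr_ge0 // ltW.
rewrite lt_neqAle sumr_ge0 // andbT eq_sym; apply/eqP => sum0.
have /eqP := w1; rewrite big1 => [|j _]; first by rewrite eq_sym oner_eq0.
have /eqP : w j * x j = 0 by apply: (psumr_eq0P _ sum0).
by rewrite mulf_eq0 [x j == 0]gt_eqF // orbF => /eqP.
Qed.

Lemma coercive_average (R : realType) (X : set R) (n : nat) (w : 'I_n -> R)
    (q : 'I_n -> R -> R) :
  (forall i, 0 <= w i) -> \sum_i w i = 1 ->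
  (forall i, exists K, 0 <= K /\ coercive X (q i) K) ->
  exists K, coercive X (fun x => \sum_i w i * q i x) K.
Proof.
move=> w_ge0 w1 /choice[K coer]; exists (\sum_i K i) => x Xx.
have K_le i : K i <= \sum_i K i.
  by rewrite (bigD1 i) //= lerDl sumr_ge0 // => j _; case: (coer j).
split=> xK.
  apply: average_gt0 => // i; apply: ((coer i).2 x Xx).1.
  exact: le_lt_trans xK.
rewrite -oppr_gt0 -sumrN; under eq_bigr do rewrite -mulrN.
apply: average_gt0 => // i; rewrite oppr_gt0; apply: ((coer i).2 x Xx).2.
by apply: lt_le_trans xK _; rewrite lerN2.
Qed.

(** By the sign of [q] at [M] and [- M], a point beyond one of these ends has a larger value than
    that end. Minimizing over [X] thus reduces to the compact part of [X] within [[-M, M]]. *)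
Lemma argmin_compact (R : realType) (X : set R) (L K : R) (p q : R -> R) :
  X !=set0 -> closed X -> is_interval X -> subgradient X p q ->
  (forall x, X x -> `|q x| <= L) -> coercive X q K ->
  argmin X p !=set0 /\ compact (argmin X p).
Proof.
move=> [x0 Xx0] clX itvX sub q_le coer.
have p_lip := subgradient_lipschitz sub q_le.
(* Exceeding [K] gives the strict signs of [q]; exceeding the absolute value of [x0] puts an end
   between [x0] and any point outside, hence in [X]. *)
pose M := Num.max K `|x0| + 1.
have KM : K < M by rewrite ltr_pwDr // le_max lexx.
have x0M : - M < x0 < M by rewrite -ltr_norml ltr_pwDr // le_max lexx orbT.
have outside x : X x -> M < `|x| -> exists2 y, X y /\ `|y| <= M & p y < p x.
  move=> Xx; rewrite lter_normr => /orP[Mx|Mx].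
    have XM : X M by apply: (itvX x0 x) => //; lra.
    exists M; first by rewrite ger0_norm //; lra.
    have := sub M x XM Xx; have := (coer M XM).1 KM; nra.
  have XM : X (- M) by apply: (itvX x x0) => //; lra.
  exists (- M); first by rewrite normrN ger0_norm //; lra.
  have : - M < - K by rewrite ltrN2.
  have := sub (- M) x XM Xx; move=> h /(coer _ XM).2; nra.
have cptC : compact (`[- M, M]%classic `&` X).
  exact: compact_closedI (@segment_compact _ _ _) clX.
have inC x : X x -> `|x| <= M -> x \in `[- M, M]%classic `&` X.
  by move=> Xx xM; rewrite inE; split => //=; rewrite in_itv /= -ler_norml.
split.
  have C_neq0 : (`[- M, M]%classic `&` X) !=set0.
    by exists x0; split => //=; rewrite in_itv /=; lra.
  have [|z] := compact_EVT_min (f := p) C_neq0 cptC.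
    by apply: (@lipschitz_within _ _ _ L) => x y [_ Xx] [_ Xy]; exact: p_lip.
  rewrite inE => -[_ Xz] z_min; exists z; split=> // x Xx.
  have [xM|/(outside x Xx) [y [Xy yM] /ltW]] := leP `|x| M.
    exact: z_min (inC x Xx xM).
  exact: le_trans (z_min y (inC y Xy yM)).
apply: subclosed_compact cptC _; last first.
  move=> x [Xx x_min]; have [xM|/(outside x Xx) [y [Xy _]]] := leP `|x| M.
    by have := inC x Xx xM; rewrite inE.
  by rewrite ltNge x_min.
rewrite closure_id; apply/seteqP; split; first exact: subset_closure.
move=> x clx.
have Xx : X x.
  rewrite closure_id in clX; rewrite clX.
  by apply: closure_subset clx => y [].
split=> // y Xy; apply/ler_addgt0Pr => eps eps_gt0.
have L_gt0 : 0 < `|L| + 1 by rewrite ltr_pwDr.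
have [z [[Xz z_min]]] :=
  clx _ (nbhsx_ballx x (eps / (`|L| + 1)) (divr_gt0 eps_gt0 L_gt0)).
rewrite /ball /= ltr_pdivlMr // => xz.
have := p_lip x z Xx Xz; have := z_min y Xy; rewrite ler_norml.
have := ler_norm L; have := normr_ge0 (x - z); nra.
Qed.

Lemma compact_extrema (R : realType) (A : set R) :
  A !=set0 -> compact A ->
  exists a b, [/\ A a, A b & forall x, A x -> a <= x <= b].
Proof.
move=> A_neq0 cptA.
have idc : {within A, continuous (@idfun R)}.
  by apply: (@lipschitz_within _ _ _ 1) => x y _ _; rewrite mul1r.
have [a] := compact_EVT_min A_neq0 cptA idc.
have [b] := compact_EVT_max A_neq0 cptA idc.
rewrite !inE => Ab b_max Aa a_min; exists a, b; split=> // x /mem_set Ax.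
by rewrite a_min //= b_max.
Qed.

(** If [q z] is nonnegative, the tangent at [z] shows [p z <= p b]; otherwise it shows
    [p z <= p a]. *)
Lemma argmin_interval (R : realType) (X : set R) (p q : R -> R) :
  is_interval X -> subgradient X p q -> is_interval (argmin X p).
Proof.
move=> itvX sub a b [Xa a_min] [Xb b_min] z /andP[az zb].
have Xz : X z by apply: (itvX a b) => //; rewrite az.
split=> // y Xy; have := sub z a Xz Xa; have := sub z b Xz Xb.
have := a_min y Xy; have := b_min y Xy.
by have [q_ge0|q_lt0] := leP 0 (q z); nra.
Qed.

Lemma dist_ge0 (R : realType) (x : R) (S : set R) : (0 <= dist x S)%E.
Proof. by apply: le_ereal_inf_tmp => _ [y _ <-]; rewrite lee_fin. Qed.

Lemma dist_le (R : realType) (x y : R) (S : set R) :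
  S y -> (dist x S <= (`|x - y|)%:E)%E.
Proof. by move=> Sy; apply: ereal_inf_lbound; exists y. Qed.

(** * Projected gradient descent over a fixed stochastic matrix *)

Lemma cvg_sqr0 (R : realType) (u : nat -> R) :
  (forall t, 0 < u t) -> (fun t => u t ^+ 2) @ \oo --> 0 -> u @ \oo --> 0.
Proof.
move=> u_gt0 /cvgrPdist_le u2; apply/cvgrPdist_le => d d_gt0.
apply: filterS (u2 (d ^+ 2) (exprn_gt0 2 d_gt0)) => t.
rewrite !sub0r !normrN normrX.
by rewrite ler_sqr ?nnegrE // ltW.
Qed.

Lemma admissible_lipschitz (R : realType) (X : set R) (L : R) (g g' : R -> R) :
  admissible X L g g' -> forall x y, X x -> X y -> `|g' x - g' y| <= L * `|x - y|.
Proof. by move=> adm x y Xx Xy; exact: ((adm_lipschitz adm) (x, y) (conj Xx Xy)). Qed.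

Lemma averageN (R : realType) (n : nat) (w x : 'I_n -> R) :
  \sum_j w j * - x j = - \sum_j w j * x j.
Proof. by rewrite -sumrN; apply: eq_bigr => j _; rewrite mulrN. Qed.

(** Crashes no longer appear: from some time on, every index follows the same update with a fixed
    matrix. The bound by [a] comes from the bound by [b] on negated data. *)
Lemma projected_descent_converges (R : realType) (X : set R) (L : R) (n : nat)
    (h dh : 'I_n -> R -> R) (lambda : nat -> R) (A : 'M[R]_n) (pi : 'I_n -> R)
    (c : R) (k : nat) (l : 'I_n) (x : nat -> 'I_n -> R) :
  X !=set0 -> closed X -> is_interval X ->
  (forall i, admissible X L (h i) (dh i)) -> stepsizes lambda ->
  stochastic A -> stationary A pi ->
  0 < c -> (0 < k)%N -> (forall i, c <= (A ^+ k) i l) ->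
  (forall t i, X (x t i)) ->
  (\forall t \near \oo, forall i, x t.+1 i
     = proj_onto X (\sum_j A i j * x t j - lambda t * dh i (x t i))) ->
  (forall d, 0 < d -> \forall t \near \oo, spread_le (x t) d) /\
  forall i, dist (x t i) (argmin X (fun y => \sum_i pi i * h i y))
    @[t --> \oo] --> 0%E.
Proof.
move=> X_neq0 clX itvX adm steps stA stpi c_gt0 k_gt0 cA Xx update.
have [A_ge0 A1] := stA; have [pi_ge0 pi1 _] := stpi.
have lambda_gt0 := step_gt0 steps.
pose v t i := \sum_j A i j * x t j.
pose g t i := dh i (x t i).
have Xv t i : X (v t i) by exact: average_interval.
have small d : 0 < d -> \forall t \near \oo, forall i, `|lambda t * g t i| <= d.
  move=> d_gt0; have /cvgrPdist_le/(_ d d_gt0) : (lambda t * L) @[t --> \oo] --> 0 * L.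
    apply: cvgMl; apply: cvg_sqr0 => //.
    exact: cvg_series_cvg_0 (step_series2 steps).
  apply: filterS => t; rewrite mul0r sub0r normrN => lambdaL i.
  apply: le_trans lambdaL; rewrite !normrM ler_wpM2l //.
  exact: le_trans (adm_bounded (adm i) (Xx t i)) (ler_norm _).
have agree d : 0 < d -> \forall t \near \oo, spread_le (x t) d.
  apply: (consensus stA c_gt0 k_gt0 cA) => {}d d_gt0; near=> t => i.
  have -> : x t.+1 i = proj_onto X (v t i - lambda t * g t i).
    by move: i; near: t.
  have : `|lambda t * g t i| <= d by move: i; near: t; exact: small.
  (* As [v t i] is in [X], the projected point lies between it and the end of the gradient step, so
     projecting does not lengthen the step. *)
  have := proj_onto_between (v t i - lambda t * g t i) itvX clX (Xv t i).
  rewrite ge_min le_max !ler_norml -/(v t i).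
  by move=> /andP[/orP[?|?] /orP[?|?]]; lra.
split=> // i0.
pose p y := \sum_i pi i * h i y; pose q y := \sum_i pi i * dh i y.
have sub_i i := admissible_subgradient itvX (adm i).
have sub : subgradient X p q by exact: subgradient_average.
have q_le y : X y -> `|q y| <= L.
  move=> Xy; rewrite ler_norml average_ge ?average_le // => i;
    by have := adm_bounded (adm i) Xy; rewrite ler_norml => /andP[].
have [K coer] : exists K, coercive X q K.
  apply: coercive_average => // i; apply: (coercive_compact_argmin (sub_i i)).
    exact: adm_argmin_neq0 (adm i).
  exact: adm_argmin_compact (adm i).
have [min_neq0 min_cpt] := argmin_compact X_neq0 clX itvX sub q_le coer.
have [a [b [a_min b_min ab]]] := compact_extrema min_neq0 min_cpt.
have [Xa _] := a_min; have [Xb _] := b_min.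
pose y t := \sum_i pi i * x t i.
have Xy t : X (y t) by exact: average_interval.
(* Gradients at the separate states differ little from those at [y t], by their Lipschitz bound and
   consensus. *)
have grad_near d : 0 < d -> \forall t \near \oo, `|\sum_i pi i * g t i - q (y t)| <= d.
  move=> d_gt0; have L_gt0 : 0 < `|L| + 1 by rewrite ltr_pwDr.
  apply: filterS (agree _ (divr_gt0 d_gt0 L_gt0)) => t x_spread.
  have gi i : `|g t i - dh i (y t)| <= d.
    have := spread_le_average pi_ge0 pi1 x_spread i.
    rewrite -/(y t) ler_pdivlMr //.
    have := admissible_lipschitz (adm i) (Xx t i) (Xy t); rewrite -/(g t i).
    have := ler_norm L; have := normr_ge0 (x t i - y t); nra.
  rewrite -sumrB; under eq_bigr do rewrite -mulrBr.
  by rewrite ler_norml average_ge ?average_le // => i;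
    have := gi i; rewrite ler_norml => /andP[].
have below eps : 0 < eps -> \forall t \near \oo, forall i, x t i <= b + eps.
  apply: (@eventually_below _ _ A pi x g lambda b) => //.
  - exact: step_series steps.
  - apply: filterS update => t xt i; rewrite xt.
    by case/andP: (proj_onto_between (v t i - lambda t * g t i) itvX clX Xb).
  move=> {}eps eps_gt0; have [X_eps|nX] := pselect (X (b + eps)); last first.
    (* If [b + eps] is outside the interval [X], then [y t] cannot reach it; the implication is
       vacuous and any positive constant serves. *)
    exists 1 => //; apply: nearW => t ?; case: nX; apply: (itvX b (y t)) => //.
    by rewrite lerDl ltW.
  have q_gt0 : 0 < q (b + eps).
    apply: (subgradient_outside_argmin sub b_min X_eps _).1; last by rewrite ltrDl.
    by move=> /ab; lra.
  (* Past [b + eps], monotonicity keeps [q (y t)] at least [q (b + eps)]; half of it is given up to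
     the error in [grad_near]. *)
  exists (q (b + eps) / 2); first by rewrite divr_gt0.
  have q2 : 0 < q (b + eps) / 2 by rewrite divr_gt0.
  apply: filterS (grad_near _ q2) => t.
  have := subgradient_nondecreasing sub X_eps (Xy t).
  by rewrite ler_norml -/(y t) => mono ? /mono; lra.
have above eps : 0 < eps -> \forall t \near \oo, forall i, - x t i <= - a + eps.
  apply: (@eventually_below _ _ A pi (fun t i => - x t i) (fun t i => - g t i)
            lambda (- a)) => //.
  - exact: step_series steps.
  - apply: filterS update => t xt i; rewrite xt.
    have := proj_onto_between (v t i - lambda t * g t i) itvX clX Xa.
    rewrite averageN mulrN -opprD -oppr_min lerN2.
    by case/andP.
  - move=> d d_gt0; apply: filterS (small d d_gt0) => t xt i.
    by rewrite mulrN normrN.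
  - move=> d d_gt0; apply: filterS (agree d d_gt0) => t [m xm].
    by exists (- m - d) => i; have := xm i; lra.
  move=> {}eps eps_gt0; have [X_eps|nX] := pselect (X (a - eps)); last first.
    exists 1 => //; apply: nearW => t.
    rewrite averageN -/(y t) => ?; case: nX; apply: (itvX (y t) a) => //.
    by apply/andP; split; lra.
  have q_lt0 : q (a - eps) < 0.
    apply: (subgradient_outside_argmin sub a_min X_eps _).2; last by lra.
    by move=> /ab; lra.
  have q2 : 0 < - q (a - eps) / 2 by rewrite divr_gt0 // oppr_gt0.
  exists (- q (a - eps) / 2) => //.
  apply: filterS (grad_near _ q2) => t.
  rewrite !averageN -/(y t).
  have := subgradient_nondecreasing sub (Xy t) X_eps.
  rewrite ler_norml => mono ? ?; have := mono _; lra.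
(* Clamping the state to [[a, b]] gives a minimizer, and its distance to the state tends to 0. *)
pose w t := Num.min (Num.max (x t i0) a) b.
have w_min t : argmin X p (w t).
  apply: (argmin_interval itvX sub a_min b_min).
  have /andP[_ le_ab] := ab a a_min.
  by rewrite /w le_min le_max lexx orbT le_ab ge_min lexx orbT.
have w_near : `|x t i0 - w t| @[t --> \oo] --> 0.
  apply/cvgrPdist_le => eps eps_gt0; near=> t.
  have xb : x t i0 <= b + eps by move: (i0); near: t; exact: below.
  have xa : - x t i0 <= - a + eps by move: (i0); near: t; exact: above.
  have /andP[_ le_ab] := ab a a_min.
  rewrite sub0r normrN normr_id /w.
  by case: (leP (x t i0) a) => ?; case: (leP _ b) => ?; rewrite ler_norml; lra.
apply: (@squeeze_cvge _ _ _ _ (fun=> 0%E) _ (fun t => (`|x t i0 - w t|)%:E)).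
- by apply: nearW => t; rewrite dist_ge0 dist_le.
- exact: cvg_cst.
- by apply: cvg_EFin => //; exact: nearW.
Unshelve. all: by end_near.
Qed.

(** * The communication graph after the last crash *)

Definition live_row (n : nat) (e : rel 'I_n) (F : {set 'I_n}) (i : 'I_n) :
    {set 'I_n} :=
  (i |: in_neighbours e i :&: ~: F)%SET.

(* Rows indexed by F copy the row of a surviving agent [i0], so that the matrix
   is stochastic and its columns indexed by F vanish. *)
Definition survivor (n : nat) (F : {set 'I_n}) (i0 i : 'I_n) : 'I_n :=
  if i \in F then i0 else i.

Definition live_matrix (R : realType) (n : nat) (e : rel 'I_n) (F : {set 'I_n})
    (i0 : 'I_n) : 'M[R]_n :=
  \matrix_(i, j) if j \in live_row e F (survivor F i0 i)
                 then (#|live_row e F (survivor F i0 i)|%:R)^-1 else 0.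

Lemma survivorP (n : nat) (F : {set 'I_n}) (i0 i : 'I_n) :
  i0 \notin F -> survivor F i0 i \notin F.
Proof. by rewrite /survivor; case: ifPn. Qed.

Lemma survivor_id (n : nat) (F : {set 'I_n}) (i0 i : 'I_n) :
  i \notin F -> survivor F i0 i = i.
Proof. by rewrite /survivor => /negbTE ->. Qed.

Lemma live_row_notin (n : nat) (e : rel 'I_n) (F : {set 'I_n}) (i j : 'I_n) :
  i \notin F -> j \in live_row e F i -> j \notin F.
Proof. by move=> iF; rewrite !inE => /predU1P[->|/andP[]]. Qed.

Lemma live_matrix_average (R : realType) (n : nat) (e : rel 'I_n)
    (F : {set 'I_n}) (i0 i : 'I_n) (x : 'I_n -> R) :
  \sum_j live_matrix R e F i0 i j * x j
  = (#|live_row e F (survivor F i0 i)|%:R)^-1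
    * \sum_(j in live_row e F (survivor F i0 i)) x j.
Proof.
rewrite mulr_sumr [RHS]big_mkcond /=; apply: eq_bigr => j _.
by rewrite mxE; case: ifP; rewrite ?mul0r.
Qed.

Lemma card_live_row_gt0 (n : nat) (e : rel 'I_n) (F : {set 'I_n}) (i : 'I_n) :
  (0 < #|live_row e F i|)%N.
Proof. by apply/card_gt0P; exists i; rewrite setU11. Qed.

Lemma live_matrix_stochastic (R : realType) (n : nat) (e : rel 'I_n)
    (F : {set 'I_n}) (i0 : 'I_n) :
  stochastic (live_matrix R e F i0).
Proof.
split=> [i j|i]; first by rewrite mxE; case: ifP; rewrite ?invr_ge0.
have := live_matrix_average e F i0 i (fun=> 1 : R).
under eq_bigr do rewrite mulr1.
move=> ->; rewrite sumr_const mulVf // pnatr_eq0 -lt0n.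
exact: card_live_row_gt0.
Qed.

Lemma live_matrix_ge (R : realType) (n : nat) (e : rel 'I_n) (F : {set 'I_n})
    (i0 i j : 'I_n) :
  j \in live_row e F (survivor F i0 i) ->
  ((max_in_degree e).+1%:R)^-1 <= live_matrix R e F i0 i j.
Proof.
move=> ij; rewrite mxE ij lef_pV2 ?posrE ?ltr0n ?card_live_row_gt0 //.
rewrite ler_nat cardsU1 -add1n leq_add ?leq_b1 //.
apply: leq_trans (leq_bigmax (survivor F i0 i)).
by apply: subset_leq_card; exact: subsetIl.
Qed.

(** Each edge of the path costs one factor, and the self-loops in [live_row] pad short paths. The
    exponent exceeds the bound on the length by one because row [i] may belong to a crashed agent:
    passing to its survivor takes a step even when the path is empty. *)
Lemma live_matrix_path (R : realType) (n : nat) (e : rel 'I_n) (F : {set 'I_n})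
    (i0 : 'I_n) (k : nat) (i j : 'I_n) (s : seq 'I_n) :
  i0 \notin F -> path (reduced_graph e F) j s ->
  last j s = survivor F i0 i -> (size s <= k)%N ->
  ((max_in_degree e).+1%:R)^-1 ^+ k.+1 <= (live_matrix R e F i0 ^+ k.+1) i j.
Proof.
move=> i0F; pose c : R := ((max_in_degree e).+1%:R)^-1.
have c_ge0 : 0 <= c by rewrite invr_ge0.
have stA := live_matrix_stochastic R e F i0.
have step m u v : v \in live_row e F (survivor F i0 u) ->
    c ^+ m.+1 <= (live_matrix R e F i0 ^+ m.+1) v j ->
    c ^+ m.+2 <= (live_matrix R e F i0 ^+ m.+2) u j.
  move=> uv IH; rewrite (exprS (live_matrix R e F i0)) mxE (bigD1 v) //= (exprS c).
  have [A_ge0 _] := stA; have [Am_ge0 _] := stochasticX m.+1 stA.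
  rewrite -[leLHS]addr0 lerD ?sumr_ge0 // => [|w _]; last by rewrite mulr_ge0.
  by rewrite ler_pM ?exprn_ge0 //; exact: live_matrix_ge.
elim: k i s => [|k IH] i s.
  case: s => //= _ j_last _; rewrite !expr1.
  by apply: live_matrix_ge; rewrite -j_last setU11.
case/lastP: s => [_ j_last _|s z].
  apply: (step _ _ (survivor F i0 i)); first by rewrite setU11.
  by apply: (IH _ [::]) => //=; rewrite survivor_id // survivorP.
rewrite rcons_path last_rcons size_rcons ltnS => /andP[js /and3P[lF _ lz]] z_last sk.
apply: (step _ _ (last j s)).
  by rewrite -z_last !inE lF lz orbT.
by apply: (IH _ s) => //; rewrite survivor_id.
Qed.

Lemma live_matrix_source (R : realType) (n : nat) (e : rel 'I_n)
    (F : {set 'I_n}) (i0 i j : 'I_n) :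
  i0 \notin F -> j \in source_component e F ->
  1 / ((max_in_degree e).+1%:R ^+ n) <= (live_matrix R e F i0 ^+ n) i j.
Proof.
move=> i0F; rewrite !inE => /andP[jF /forallP /(_ (survivor F i0 i))].
rewrite inE survivorP //= => /connectP[s0 js].
(* A path without repeated nodes has at most [n - 1] edges, which fits the exponent [n]. *)
case: (shortenP js) => s es s_uniq _ s_last {s0 js}.
have n_gt0 : (0 < n)%N by exact: leq_ltn_trans (ltn_ord i).
have s_size : (size s < n)%N.
  have := card_uniqP s_uniq; have := max_card [in j :: s].
  by rewrite card_ord => /[swap] ->.
have [m nE sm] : exists2 m, n = m.+1 & (size s <= m)%N.
  by exists n.-1; [rewrite prednK | rewrite -ltnS prednK].
have := live_matrix_path R i0F es (esym s_last) sm.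
by rewrite -nE exprVn div1r.
Qed.

(** Crashes are permanent and the agents finitely many, so nothing changes after the largest of the
    times [T i]. *)
Lemma crash_pattern_settles (n : nat) (F : {set 'I_n})
    (alive : nat -> {set 'I_n}) :
  crash_pattern F alive -> \forall t \near \oo, alive t.+1 = ~: F.
Proof.
move=> [alive_dec aliveF].
have anti s t : (s <= t)%N -> alive t.+1 \subset alive s.+1.
  move=> /subnK <-; elim: (t - s)%N => [|m IH] //.
  exact: fintype.subset_trans (alive_dec _) IH.
have /choice[T crashed] : forall i, exists t, i \in F -> i \notin alive t.+1.
  move=> i; have [iF|] := boolP (i \in F); last by exists 0%N.
  by have [t it] := (aliveF i).1 iF; exists t.
exists (\max_i T i)%N => // t /= t_ge; apply/setP => i; rewrite inE.
apply/idP/idP => [i_alive|]; last first.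
  by apply: contraNT => i_dead; apply/(aliveF i).2; exists t.
apply: contraTN i_alive => iF; apply: contra (crashed i iF).
by apply/fintype.subsetP/anti; exact: leq_trans (leq_bigmax i) t_ge.
Qed.

Lemma execution_states (R : realType) (X : set R) (n : nat) (e : rel 'I_n)
    (dh : 'I_n -> R -> R) (lambda : nat -> R) (F : {set 'I_n})
    (alive : nat -> {set 'I_n}) (rcv : nat -> 'I_n -> {set 'I_n})
    (x : nat -> 'I_n -> R) :
  X !=set0 -> closed X -> crash_pattern F alive ->
  execution X e dh lambda alive rcv x ->
  forall t i, i \notin F -> X (x t i).
Proof.
move=> X_neq0 clX crash exec [|t] i iF; first exact: exec_init exec i.
have i_alive : i \in alive t.+2.
  by apply: contraNT iF => i_dead; apply: (crash_set crash i).2; exists t.+1.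
rewrite (exec_update exec i_alive); exact: (proj_ontoP _ X_neq0 clX).1.
Qed.

(** Once the live agents at the beginning and at the end of an iteration are the complement of [F],
    the two bounds on the received set coincide. *)
Lemma execution_update (R : realType) (X : set R) (n : nat) (e : rel 'I_n)
    (dh : 'I_n -> R -> R) (lambda : nat -> R) (F : {set 'I_n})
    (alive : nat -> {set 'I_n}) (rcv : nat -> 'I_n -> {set 'I_n})
    (x : nat -> 'I_n -> R) :
  irreflexive e -> crash_pattern F alive ->
  execution X e dh lambda alive rcv x ->
  \forall t \near \oo, forall i, i \notin F ->
    x t.+1 i = proj_onto X
      ((#|live_row e F i|%:R)^-1 * (\sum_(j in live_row e F i) x t j)
       - lambda t * dh i (x t i)).
Proof.
move=> e_irr crash exec.
have [t0 _ settled] := crash_pattern_settles crash.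
exists t0 => // t /= t0t i iF.
have alive1 := settled t t0t; have alive2 := settled t.+1 (leqW t0t).
have rcvE : rcv t.+1 i = (in_neighbours e i :&: ~: F)%SET.
  apply/eqP; rewrite finset.eqEsubset -{1}alive1 -alive2.
  by rewrite (exec_rcv_ub exec) ?(exec_rcv_lb exec) // alive1 inE.
(* Without self-loops [i] is not in its received set, so [live_row] has exactly one more element, as
   the divisor requires. *)
rewrite (exec_update exec) ?alive2 ?inE // rcvE /live_row cardsU1.
by rewrite !inE e_irr.
Qed.

Theorem theorem6 (R : realType)
  (X : set R) (X_neq0 : X !=set0) (X_closed : closed X)
  (X_convex : @convex_set R R^o X)
  (L : R) (n : nat) (h dh : 'I_n -> R -> R)
  (h_admissible : forall i, admissible X L (h i) (dh i))
  (lambda : nat -> R) (lambda_steps : stepsizes lambda)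
  (e : rel 'I_n) (e_irr : irreflexive e)
  (f : nat) (F : {set 'I_n}) (F_le_f : (#|F| <= f)%N) (f_lt_n : (f < n)%N)
  (alive : nat -> {set 'I_n}) (alive_F : crash_pattern F alive)
  (rcv : nat -> 'I_n -> {set 'I_n}) (x : nat -> 'I_n -> R)
  (x_exec : execution X e dh lambda alive rcv x)
  (gamma : nat) (gamma_ge1 : (1 <= gamma)%N)
  (beta : R) (beta_le : beta <= 1 / ((max_in_degree e).+1%:R ^+ n))
  (sources : forall F' : {set 'I_n}, F' \subset F ->
     (gamma <= #|source_component e F'|)%N) :
  (forall i j, i \in ~: F -> j \in ~: F ->
     `|x t i - x t j| @[t --> \oo] --> 0) /\
  (forall i, i \in ~: F ->
     dist (x t i) (valid_optima X h (~: F) beta gamma) @[t --> \oo] --> 0%E).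
Proof.
have n_gt0 : (0 < n)%N by apply: leq_ltn_trans f_lt_n.
have [i0 i0F] : exists i0, i0 \notin F.
  apply/existsP; apply: contraLR F_le_f; rewrite negb_exists -ltnNge => /forallP allF.
  have -> : F = [set: 'I_n]%SET.
    by apply/setP => i; rewrite inE; have := allF i; rewrite negbK.
  by rewrite cardsT card_ord.
pose A := live_matrix R e F i0; pose r := survivor F i0.
have stA : stochastic A by exact: live_matrix_stochastic.
have [pi stpi] := stationary_exists n_gt0 stA.
have [pi_ge0 pi1 piA] := stpi.
have rF i : r i \notin F by exact: survivorP.
have A_F i j : j \in F -> A i j = 0.
  move=> jF; rewrite mxE ifN //; apply: contraTN jF; exact: live_row_notin.
have pi_F j : j \in F -> pi j = 0.
  by move=> jF; rewrite -piA big1 // => i _; rewrite A_F // mulr0.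
pose c : R := 1 / ((max_in_degree e).+1%:R ^+ n).
have c_gt0 : 0 < c by rewrite divr_gt0 // exprn_gt0.
have cA l i : l \in source_component e F -> c <= (A ^+ n) i l.
  exact: live_matrix_source.
have [l l_source] : exists l, l \in source_component e F.
  by apply/card_gt0P; apply: leq_trans gamma_ge1 (sources _ _).
have itvX := convex_set_interval X_convex.
(* States are relabelled by [r]: an agent of [F] is given the trajectory of [i0], so the update
   holds for every index and the unconstrained states of crashed agents never enter. *)
have update : \forall t \near \oo, forall i, x t.+1 (r i)
    = proj_onto X (\sum_j A i j * x t (r j) - lambda t * dh (r i) (x t (r i))).
  apply: filterS (execution_update e_irr alive_F x_exec) => t xt i.
  rewrite xt // live_matrix_average; congr (proj_onto X (_ * _ - _)).
  apply: eq_bigr => j /(live_row_notin (rF i)) jF.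
  by rewrite /r survivor_id.
have [agree dist_cvg] := projected_descent_converges X_neq0 X_closed itvX
  (fun i => h_admissible (r i)) lambda_steps stA stpi c_gt0 n_gt0
  (fun i => cA l i l_source)
  (fun t i => execution_states X_neq0 X_closed alive_F x_exec t (rF i)) update.
(* Relabelling changes only functions of weight zero in [pi], so the objective is the original
   combination. *)
have pE : (fun y => \sum_i pi i * h (r i) y) = (fun y => \sum_i pi i * h i y).
  apply/funext => y; apply: eq_bigr => i _.
  have [iF|iF] := boolP (i \in F); first by rewrite pi_F // !mul0r.
  by rewrite /r survivor_id.
split=> [i j|i]; rewrite !inE.
  move=> iF jF; apply/cvgrPdist_le => eps eps_gt0.
  apply: filterS (agree eps eps_gt0) => t /spread_leP /(_ i j).
  by rewrite /r !survivor_id // sub0r normrN normr_id.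
move=> iF; have := dist_cvg i; rewrite pE /r survivor_id // => p_cvg.
(* The distance to the larger set of valid optima is squeezed below the distance to the minimizers
   of this combination; it remains to see that [pi] gives a valid function. *)
apply: squeeze_cvge (cvg_cst 0%E) p_cvg.
apply: nearW => t; rewrite dist_ge0 /=.
apply: ereal_inf_le_tmp; apply: image_subset; apply: bigcup_sup.
exists pi; split=> //.
apply: leq_trans (sources F (subxx _)) _.
apply: subset_leq_card; apply/fintype.subsetP => j j_source.
have := j_source; rewrite !inE => /andP[-> _] /=.
(* As [pi] is also stationary for [A ^+ n], [pi j] is an average of column [j] of that power, whose
   entries are at least [c]. *)
apply: le_trans beta_le _; have [_ _ piAn] := stationaryX n stpi.
have [An_ge0 _] := stochasticX n stA.
rewrite -[leRHS]piAn; apply: average_ge => // i'.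
exact: cA.
Qed.
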